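(* Let $\alpha,\beta\in\mathbb{C}$, $p\in\mathbb{C}^*$, and let $V$ be one of the conformal modules $V_{a,b}$ (for $p\ne-1$, $(\alpha,\beta)\neq(p,0)$), $V_{a,b,d}$ (for $p\neq-1$, $(\alpha,\beta)=(p,0)$), $V_{a,b,c}$ (for $p=-1$, $(\alpha,\beta)\neq(-1,0)$), $V_{a,b,c,d}$ (for $p=-1$, $(\alpha,\beta)=(-1,0)$) over $\mathfrak{B}(\alpha,\beta,p)$, where $a,b,c,d\in\mathbb{C}$. (1) If $V\cong V_{a,b}$, then $V$ is irreducible if and only if $a\neq0$. The module $V_{0,b}$ contains a unique non-trivial submodule $(\partial+b)V_{0,b}\cong V_{1,b}$. (2) If $V\cong V_{a,b,d}$, then $V$ is irreducible if and only if $a\neq0$ or $d\neq0$. The module $V_{0,b,0}$ (with $a=d=0$) contains a unique non-trivial submodule $(\partial+b)V_{0,b,0}\cong V_{1,b,0}$ (with $a=1$, $d=0$). (3) If $V\cong V_{a,b,c}$, then $V$ is irreducible if and only if $a\neq0$ or $c\neq0$. The module $V_{0,b,0}$ (with $a=c=0$) contains a unique non-trivial submodule $(\partial+b)V_{0,b,0}\cong V_{1,b,0}$ (with $a=1$, $c=0$). (4) If $V\cong V_{a,b,c,d}$, then $V$ is irreducible if and only if $a\neq0$ or $c\neq0$ or $d\neq0$. The module $V_{0,b,0,0}$ contains a unique non-trivial submodule $(\partial+b)V_{0,b,0,0}\cong V_{1,b,0,0}$.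
   Context: All vector spaces are over $\mathbb{C}$; $\mathbb{C}^*=\mathbb{C}\setminus\{0\}$, $\mathbb{Z}_+=\{0,1,2,\dots\}$. A Lie conformal algebra is a $\mathbb{C}[\partial]$-module $R$ with a linear map $R\otimes R\to R[\lambda]=\mathbb{C}[\lambda]\otimes R$, $a\otimes b\mapsto[a\,{}_\lambda\,b]$, such that $[\partial a\,{}_\lambda\,b]=-\lambda[a\,{}_\lambda\,b]$, $[a\,{}_\lambda\,\partial b]=(\partial+\lambda)[a\,{}_\lambda\,b]$, $[a\,{}_\lambda\,b]=-[b\,{}_{-\lambda-\partial}\,a]$, and $[a\,{}_\lambda[b\,{}_\mu\,c]]=[[a\,{}_\lambda\,b]\,{}_{\lambda+\mu}\,c]+[b\,{}_\mu[a\,{}_\lambda\,c]]$. A conformal module over $R$ is a $\mathbb{C}[\partial]$-module $M$ with a linear map $R\otimes M\to M[\lambda]$, $a\otimes v\mapsto a\,{}_\lambda\,v$, such that $(\partial a)\,{}_\lambda\,v=-\lambda\, a\,{}_\lambda\,v$, $a\,{}_\lambda(\partial v)=(\partial+\lambda)\,a\,{}_\lambda\,v$, $a\,{}_\lambda(b\,{}_\mu\,v)-b\,{}_\mu(a\,{}_\lambda\,v)=[a\,{}_\lambda\,b]\,{}_{\lambda+\mu}\,v$. A non-trivial submodule is a submodule different from $0$ and from the whole module; a nonzero conformal module is irreducible if it has no non-trivial submodules. For $\alpha,\beta\in\mathbb{C}$, $p\in\mathbb{C}^*$, $\mathfrak{B}(\alpha,\beta,p)$ is the Lie conformal algebra that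 is free over $\mathbb{C}[\partial]$ with basis $\{L_i,W_i\mid i\in\mathbb{Z}_+\}$ and $\lambda$-brackets $[L_i\,{}_\lambda\,L_j]=\big((i+p)\partial+(i+j+2p)\lambda\big)L_{i+j}$, $[L_i\,{}_\lambda\,W_j]=\big((i+p)(\partial+\beta)+(i+j+\alpha)\lambda\big)W_{i+j}$, $[W_i\,{}_\lambda\,W_j]=0$ (with $[W_j\,{}_\lambda\,L_i]$ given by skew-symmetry). The following are conformal modules over $\mathfrak{B}(\alpha,\beta,p)$, each free of rank one over $\mathbb{C}[\partial]$ with generator $v$: - If $(\alpha,\beta)\neq(p,0)$, $a,b\in\mathbb{C}$: $V_{a,b}=\mathbb{C}[\partial]v$ with $L_0\,{}_\lambda\,v=p(\partial+a\lambda+b)v$, $W_0\,{}_\lambda\,v=0$, $L_i\,{}_\lambda\,v=W_i\,{}_\lambda\,v=0$ for $i\ge1$. - If $(\alpha,\beta)=(p,0)$, $a,b,d\in\mathbb{C}$: $V_{a,b,d}=\mathbb{C}[\partial]v$ with $L_0\,{}_\lambda\,v=p(\partial+a\lambda+b)v$, $W_0\,{}_\lambda\,v=dv$, $L_i\,{}_\lambda\,v=W_i\,{}_\lambda\,v=0$ for $i\ge1$. - If $p=-1$ and $(\alpha,\beta)\neq(-1,0)$, $a,b,c\in\mathbb{C}$: $V_{a,b,c}=\mathbb{C}[\partial]v$ with $L_0\,{}_\lambda\,v=-(\partial+a\lambda+b)v$, $L_1\,{}_\lambda\,v=cv$, $L_j\,{}_\lambda\,v=0$ for $j\ge2$, $W_i\,{}_\lambda\,v=0$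 for all $i\ge0$. - If $p=-1$ and $(\alpha,\beta)=(-1,0)$, $a,b,c,d\in\mathbb{C}$: $V_{a,b,c,d}=\mathbb{C}[\partial]v$ with $L_0\,{}_\lambda\,v=-(\partial+a\lambda+b)v$, $L_1\,{}_\lambda\,v=cv$, $L_j\,{}_\lambda\,v=0$ for $j\ge2$, $W_0\,{}_\lambda\,v=dv$, $W_i\,{}_\lambda\,v=0$ for $i\ge1$. *)

(* Defs.v *)
From HB Require Import structures.
From mathcomp Require Import all_boot all_order all_algebra.
From mathcomp Require Import ring.
From mathcomp Require Import boolp classical_sets.

Set Implicit Arguments.
Unset Strict Implicit.
Unset Printing Implicit Defensive.

Import GRing.Theory.
Local Open Scope ring_scope.
Local Open Scope classical_set_scope.

(* A C[d]-module is an [lmodType {poly C}]: d acts as ['X *: _] and the scalar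
   c of C as [c%:P *: _].  An element of M[lambda] is given by its sequence of
   coefficients [u : nat -> M], [u n] being the coefficient of lambda^n (not
   the n-th product, which is n! times it); only finitely many are nonzero. *)

Section Conformal.
Variable C : fieldType.

Definition mul_lambda (M : lmodType {poly C}) (u : nat -> M) (n : nat) : M :=
  if n is m.+1 then u m else 0.

(* Sesquilinear maps A (x) M -> M[lambda]; [act a n v] is the coefficient of
   lambda^n in a_lambda v. *)
Record lambda_action (A M : lmodType {poly C}) (act : A -> nat -> M -> M) :
    Prop := LambdaAction {
  act_finite : forall a v, exists N, forall n, (N <= n)%N -> act a n v = 0;
  act_linl : forall c a a' n v,
    act (c%:P *: a + a') n v = c%:P *: act a n v + act a' n v;
  act_linr : forall c a n v v',
    act a n (c%:P *: v + v') = c%:P *: act a n v + act a n v';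
  act_dl : forall a n v, act ('X *: a) n v = - mul_lambda (act a ^~ v) n;
  act_dr : forall a n v,
    act a n ('X *: v) = 'X *: act a n v + mul_lambda (act a ^~ v) n }.

(* Coefficient of lambda^m mu^n in [a_lambda b]_{lambda+mu} v, which is
   \sum_k lambda^k \sum_l (lambda + mu)^l c_(k,l) for
   c_(k,l) = act (br a k b) l v. *)
Definition bracket_act (A M : lmodType {poly C}) (br : A -> nat -> A -> A)
    (act : A -> nat -> M -> M) (a b : A) (v : M) (m n : nat) : M :=
  \sum_(k < m.+1) act (br a k b) (m - k + n)%N v *+ 'C(m - k + n, n).

(* Coefficient of lambda^n in u(- lambda - d) = \sum_(k < N) (- lambda - d)^k u_k
   for u in M[lambda] of lambda-degree < N. *)
Definition subst_skew (M : lmodType {poly C}) (N : nat) (u : nat -> M)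
    (n : nat) : M :=
  \sum_(k < N) ((-1) ^+ k * 'X ^+ (k - n) *+ 'C(k, n)) *: u k.

Record lieConformalAlgebra := LieConformalAlgebra {
  lca_sort :> lmodType {poly C};
  lbr : lca_sort -> nat -> lca_sort -> lca_sort;
  lbrP : lambda_action lbr;
  lbr_skew : forall a b N, (forall n, (N <= n)%N -> lbr b n a = 0) ->
    forall n, lbr a n b = - subst_skew N (lbr b ^~ a) n;
  (* coefficient of lambda^m mu^n in the Jacobi identity *)
  lbr_jacobi : forall a b c m n,
    lbr a m (lbr b n c) =
      bracket_act lbr lbr a b c m n + lbr b n (lbr a m c) }.

Record conformalModule (A : lieConformalAlgebra) := ConformalModule {
  cm_sort :> lmodType {poly C};
  lact : A -> nat -> cm_sort -> cm_sort;
  lactP : lambda_action lact;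
  (* coefficient of lambda^m mu^n *)
  lact_bracket : forall a b v m n,
    lact a m (lact b n v) - lact b n (lact a m v) =
      bracket_act (@lbr A) lact a b v m n }.

Definition isomorphic (A : lieConformalAlgebra) (M N : conformalModule A) :=
  exists f : {linear M -> N}, bijective f /\
    forall a n v, f (lact a n v) = lact a n (f v).

Record submodule (A : lieConformalAlgebra) (M : conformalModule A) :=
  Submodule {
    sub_set :> set M;
    sub0 : sub_set 0;
    subZD : forall (f : {poly C}) u v,
      sub_set u -> sub_set v -> sub_set (f *: u + v);
    sub_act : forall a n v, sub_set v -> sub_set (lact a n v) }.

Definition nontrivial (A : lieConformalAlgebra) (M : conformalModule A)
  (S : submodule M) := S <> [set 0] :> set M /\ S <> setT :> set M.

Definition irreducible (A : lieConformalAlgebra) (M : conformalModule A) :=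
  (exists v : M, v <> 0) /\ ~ (exists S : submodule M, nontrivial S).

Definition unique_nontrivial (A : lieConformalAlgebra) (M : conformalModule A)
    (S : submodule M) :=
  nontrivial S /\
  forall T : submodule M, nontrivial T -> T = S :> set M.

Section SubModule.
Variables (A : lieConformalAlgebra) (M : conformalModule A) (S : submodule M).

Definition sub_pred : {pred M} := mem (sub_set S).

Lemma sub_predP v : reflect (sub_set S v) (v \in sub_pred).
Proof. by apply: (iffP idP) => [/set_mem|/mem_set]. Qed.

Fact sub_pred_closed : submod_closed sub_pred.
Proof.
split; first by apply/sub_predP/sub0.
by move=> f u v /sub_predP uS /sub_predP vS; apply/sub_predP/subZD.
Qed.
HB.instance Definition _ :=
  GRing.isSubmodClosed.Build {poly C} M sub_pred sub_pred_closed.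

Definition sub_type := {v : M | v \in sub_pred}.
HB.instance Definition _ := SubChoice.on sub_type.
HB.instance Definition _ := [SubChoice_isSubLmodule of sub_type by <:].

Fact sub_lact_proof a n (v : sub_type) : lact a n (val v) \in sub_pred.
Proof. by apply/sub_predP/sub_act/sub_predP/valP. Qed.

Definition sub_lact a n (v : sub_type) : sub_type :=
  Sub (lact a n (val v)) (sub_lact_proof a n v).

Fact sub_lactP : lambda_action sub_lact.
Proof.
have [fin linl linr dl dr] := lactP M.
have val_lin f (x y : sub_type) : val (f *: x + y) = f *: val x + val y.
  exact: linearP.
have val_scale f (x : sub_type) : val (f *: x) = f *: val x by exact: linearZ.
have val_add (x y : sub_type) : val (x + y) = val x + val y by exact: raddfD.
have val_opp (x : sub_type) : val (- x) = - val x by exact: raddfN.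
have val_mul a v n : val (mul_lambda (sub_lact a ^~ v) n) =
    mul_lambda (lact a ^~ (val v)) n by case: n.
split.
- by move=> a v; have [N HN] := fin a (val v); exists N => n /HN E; apply: val_inj.
- by move=> *; apply: val_inj; rewrite val_lin; apply: linl.
- move=> c a n v v'; apply: val_inj; rewrite val_lin.
  by have := linr c a n (val v) (val v'); rewrite -val_lin.
- by move=> a n v; apply: val_inj; rewrite val_opp val_mul; apply: dl.
- move=> a n v; apply: val_inj.
  rewrite val_add val_mul val_scale.
  by have := dr a n (val v); rewrite -val_scale.
Qed.

Fact sub_lact_bracket a b v m n :
  sub_lact a m (sub_lact b n v) - sub_lact b n (sub_lact a m v) =
    bracket_act (@lbr A) sub_lact a b v m n.
Proof.
have val_sub (x y : sub_type) : val (x - y) = val x - val y by exact: raddfB.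
have val_sum (F : 'I_m.+1 -> sub_type) : val (\sum_k F k) = \sum_k val (F k).
  exact: raddf_sum.
have val_mulrn (x : sub_type) k : val (x *+ k) = val x *+ k by exact: raddfMn.
apply: val_inj; rewrite val_sub val_sum.
rewrite [LHS](lact_bracket a b (val v) m n).
by apply: eq_bigr => k _; rewrite val_mulrn.
Qed.

Definition sub_module : conformalModule A :=
  ConformalModule sub_lactP sub_lact_bracket.

End SubModule.

Section Extension.

Lemma act_span (M : lmodType {poly C}) (P : M -> Prop) (e : M) :
  (forall c u v, P u -> P v -> P (c%:P *: u + v)) ->
  (forall u, P u -> P ('X *: u)) -> P e -> forall f : {poly C}, P (f *: e).
Proof.
move=> Plin PX Pe.
have P0 : P 0 by have := Plin (-1) _ _ Pe Pe; rewrite polyCN scaleN1r addNr.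
have PZ c u : P u -> P (c%:P *: u) by move=> Pu; rewrite -[X in P X]addr0; apply: Plin.
elim/poly_ind => [|f c IH]; first by rewrite scale0r.
rewrite addrC scalerDl; apply: Plin => //.
by rewrite mulrC -scalerA; apply: PX.
Qed.

Section Basic.
Variables (A M : lmodType {poly C}).
Variable act : A -> nat -> M -> M.
Hypothesis actP : lambda_action act.

Lemma actDl a a' n v : act (a + a') n v = act a n v + act a' n v.
Proof. by rewrite -[a]scale1r (act_linl actP 1) !scale1r. Qed.
Lemma actDr a n v v' : act a n (v + v') = act a n v + act a n v'.
Proof. by rewrite -[v]scale1r (act_linr actP 1) !scale1r. Qed.
Lemma act0l n v : act 0 n v = 0.
Proof. by apply: (addIr (act 0 n v)); rewrite -actDl !add0r. Qed.
Lemma act0r a n : act a n 0 = 0.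
Proof. by apply: (addIr (act a n 0)); rewrite -actDr !add0r. Qed.
Lemma actZl c a n v : act (c%:P *: a) n v = c%:P *: act a n v.
Proof. by rewrite -[c%:P *: a]addr0 (act_linl actP) act0l addr0. Qed.
Lemma actZr c a n v : act a n (c%:P *: v) = c%:P *: act a n v.
Proof. by rewrite -[c%:P *: v]addr0 (act_linr actP) act0r addr0. Qed.
Lemma actNl a n v : act (- a) n v = - act a n v.
Proof. by apply: (addIr (act a n v)); rewrite -actDl !addNr act0l. Qed.
Lemma actNr a n v : act a n (- v) = - act a n v.
Proof. by apply: (addIr (act a n v)); rewrite -actDr !addNr act0r. Qed.

Lemma actX0l a v : act ('X *: a) 0 v = 0.
Proof. by rewrite (act_dl actP) oppr0. Qed.
Lemma actXSl a n v : act ('X *: a) n.+1 v = - act a n v.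
Proof. exact: (act_dl actP). Qed.
Lemma actX0r a v : act a 0 ('X *: v) = 'X *: act a 0 v.
Proof. by rewrite (act_dr actP) addr0. Qed.
Lemma actXSr a n v : act a n.+1 ('X *: v) = 'X *: act a n.+1 v + act a n v.
Proof. exact: (act_dr actP). Qed.
End Basic.

Section Jacobi.
Variables (A M : lmodType {poly C}).
Variables (br : A -> nat -> A -> A) (act : A -> nat -> M -> M).
Hypotheses (brP : lambda_action br) (actP : lambda_action act).

Definition jacobi a b v := forall m n,
  act a m (act b n v) - act b n (act a m v) = bracket_act br act a b v m n.

Lemma jacobi_linl c a a' b v :
  jacobi a b v -> jacobi a' b v -> jacobi (c%:P *: a + a') b v.
Proof.
move=> J J' m n; have -> : bracket_act br act (c%:P *: a + a') b v m n =
    c%:P *: bracket_act br act a b v m n + bracket_act br act a' b v m n.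
  rewrite /bracket_act scaler_sumr -big_split; apply: eq_bigr => k _ /=.
  by rewrite (act_linl brP) (act_linl actP) mulrnDl scalerMnr.
rewrite -J -J' (act_linl actP c) (act_linl actP c) (act_linr actP c).
by rewrite scalerBr opprD addrACA.
Qed.

Lemma jacobi_linm c a b b' v :
  jacobi a b v -> jacobi a b' v -> jacobi a (c%:P *: b + b') v.
Proof.
move=> J J' m n; have -> : bracket_act br act a (c%:P *: b + b') v m n =
    c%:P *: bracket_act br act a b v m n + bracket_act br act a b' v m n.
  rewrite /bracket_act scaler_sumr -big_split; apply: eq_bigr => k _ /=.
  by rewrite (act_linr brP) (act_linl actP) mulrnDl scalerMnr.
rewrite -J -J' (act_linl actP c) (act_linl actP c) (act_linr actP c).
by rewrite scalerBr opprD addrACA.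
Qed.

Lemma jacobi_linr c a b v v' :
  jacobi a b v -> jacobi a b v' -> jacobi a b (c%:P *: v + v').
Proof.
move=> J J' m n; have -> : bracket_act br act a b (c%:P *: v + v') m n =
    c%:P *: bracket_act br act a b v m n + bracket_act br act a b v' m n.
  rewrite /bracket_act scaler_sumr -big_split; apply: eq_bigr => k _ /=.
  by rewrite (act_linr actP) mulrnDl scalerMnr.
rewrite -J -J' 4!(act_linr actP c).
by rewrite scalerBr opprD addrACA.
Qed.

Lemma jacobi_Xl a b v : jacobi a b v -> jacobi ('X *: a) b v.
Proof.
move=> J [|m] n.
  rewrite !actX0l // act0r // subr0 /bracket_act big_ord_recl big_ord0 /=.
  by rewrite actX0l // act0l // mul0rn addr0.
rewrite !actXSl // actNr // -opprD J /bracket_act [RHS]big_ord_recl /=.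
rewrite actX0l // act0l // mul0rn add0r -sumrN; apply: eq_bigr => k _.
by rewrite actXSl // actNl // mulNrn.
Qed.

Lemma jacobi_Xm a b v : jacobi a b v -> jacobi a ('X *: b) v.
Proof.
move=> J m n.
have E : bracket_act br act a ('X *: b) v m n =
   \sum_(k < m.+1) act ('X *: br a k b) (m - k + n)%N v *+ 'C(m - k + n, n)
 + \sum_(k < m) act (br a k b) (m.-1 - k + n)%N v *+ 'C(m.-1 - k + n, n).
  rewrite /bracket_act; case: m => [|m].
    by rewrite big_ord0 addr0 !big_ord_recl !big_ord0 actX0r.
  rewrite big_ord_recl actX0r // [X in _ = X + _]big_ord_recl -addrA.
  congr (_ + _); rewrite -big_split /=; apply: eq_bigr => k _.
  by rewrite actXSr // actDl // mulrnDl.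
rewrite {}E; case: n => [|n].
  rewrite !actX0l // act0r // subrr big_ord_recr /= subnn actX0l // mul0rn addr0.
  apply/esym; rewrite -big_split big1 // => k _ /=.
  rewrite !addn0 !bin0; have -> : (m - k = (m.-1 - k).+1)%N.
    by case: m k => [[]//|m] k; rewrite subSn // -ltnS.
  by rewrite actXSl // mulNrn addNr.
rewrite !actXSl // actNr // -opprD J /bracket_act !big_ord_recr /= opprD.
rewrite -sumrN addrAC; congr (_ + _); last first.
  by rewrite subnn !add0n !binn actXSl // mulNrn.
rewrite -big_split; apply: eq_bigr => k _ /=.
have -> : (m - k + n.+1 = (m.-1 - k + n.+1).+1)%N.
  by rewrite -addSn; case: m k => [[]//|m] k; rewrite subSn // -ltnS.
rewrite actXSl // mulNrn binS mulrnDr opprD addrAC addNr add0r.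
have -> : (m - k + n = m.-1 - k + n.+1)%N.
  by rewrite addnS -addSn; case: m k => [[]//|m] k; rewrite subSn // -ltnS.
by [].
Qed.

Lemma jacobi_Xr a b v : jacobi a b v -> jacobi a b ('X *: v).
Proof.
move=> J m n.
pose B i j := bracket_act br act a b v i j.
have -> : bracket_act br act a b ('X *: v) m n = 'X *: B m n +
    (if m is m'.+1 then B m' n else 0) + (if n is n'.+1 then B m n' else 0).
  have -> : bracket_act br act a b ('X *: v) m n = 'X *: B m n +
      \sum_(k < m.+1) mul_lambda (act (br a k b) ^~ v) (m - k + n) *+ 'C(m - k + n, n).
    rewrite /B /bracket_act scaler_sumr -big_split; apply: eq_bigr => k _ /=.
    by rewrite (act_dr actP) mulrnDl scalerMnr.
  rewrite -addrA; congr (_ + _); rewrite /B /bracket_act.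
  case: n => [|n].
    rewrite addr0 big_ord_recr /= subnn mul0rn addr0.
    case: m => [|m]; first by rewrite big_ord0.
    apply: eq_bigr => k _; rewrite !addn0 !bin0 subSn //=.
    by rewrite -ltnS.
  case: m => [|m].
    by rewrite add0r !big_ord_recl !big_ord0 !addr0 !add0n !binn /=.
  rewrite big_ord_recr [in RHS](big_ord_recr m.+1) /= addrA.
  congr (_ + _); last by rewrite subnn !add0n !binn.
  rewrite -big_split; apply: eq_bigr => k _ /=.
  have E : (m.+1 - k = (m - k).+1)%N by rewrite subSn // -ltnS.
  by rewrite E !addnS !addSn binS mulrnDr.
rewrite /B -J !(act_dr actP) !actDr // !(act_dr actP) scalerBr.
have -> i : act a m (mul_lambda (act b ^~ v) i) = mul_lambda (fun j => act a m (act b j v)) i.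
  by case: i => //=; rewrite act0r.
have -> i : act b n (mul_lambda (act a ^~ v) i) = mul_lambda (fun j => act b n (act a j v)) i.
  by case: i => //=; rewrite act0r.
have E (x y z x' y' z' : M) :
    x + y + z - (x' + z' + y') = x - x' + (y - y') + (z - z').
  by rewrite !opprD (AC (3*3) ((1*4)*(2*6)*(3*5))).
rewrite E; congr (_ + _ + _).
  by case: m {E} => [|m] /=; rewrite ?subrr // J.
by case: n {E} => [|n] /=; rewrite ?subrr // J.
Qed.

Definition affine (x y z : C) (n : nat) : {poly C} :=
  match n with 0 => x%:P * 'X + z%:P | 1 => y%:P | _ => 0 end.

Lemma jacobi_affine a b c v u u' w
  (x1 y1 z1 x2 y2 z2 x3 y3 z3 x4 y4 z4 x5 y5 z5 x6 y6 z6 : C) :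
  (forall n, act b n v = affine x1 y1 z1 n *: u) ->
  (forall n, act a n u = affine x2 y2 z2 n *: w) ->
  (forall n, act a n v = affine x3 y3 z3 n *: u') ->
  (forall n, act b n u' = affine x4 y4 z4 n *: w) ->
  (forall n, br a n b = affine x5 y5 z5 n *: c) ->
  (forall n, act c n v = affine x6 y6 z6 n *: w) ->
  (* coefficients of d^2, d lambda, d mu, lambda^2, lambda mu, mu^2,
     d, lambda, mu, 1 *)
  [/\ x1 * x2 = x3 * x4,
      x1 * x2 + x1 * y2 - x4 * y3 = (y5 - x5) * x6,
      y1 * x2 - x3 * x4 - x3 * y4 = - x5 * x6,
      x1 * y2 = (y5 - x5) * y6 &
      y1 * y2 - y3 * y4 = (y5 - x5) * y6 - x5 * y6] ->
  [/\ - x3 * y4 = - x5 * y6,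
      x1 * z2 + z1 * x2 - x3 * z4 - z3 * x4 = z5 * x6,
      x1 * z2 + z1 * y2 - y3 * z4 = (y5 - x5) * z6 + z5 * y6,
      y1 * z2 - x3 * z4 - z3 * y4 = - x5 * z6 + z5 * y6 &
      z1 * z2 - z3 * z4 = z5 * z6] ->
  jacobi a b v.
Proof.
move=> Eb Ea Ea' Eb' Ebr Ec [e1 e2 e3 e4 e5] [e6 e7 e8 e9 e10] m n.
pose ml (g : nat -> {poly C}) i := if i is i'.+1 then g i' else 0.
pose co x y z (g : nat -> {poly C}) i j : {poly C} :=
  match i with 0 => x%:P * ('X * g j + ml g j) + z%:P * g j
             | 1 => y%:P * g j | _ => 0 end.
have comp d x y z x' y' z' t :
    (forall i, act d i t = affine x' y' z' i *: w) -> forall i j,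
    act d j (affine x y z i *: t) = co x y z (affine x' y' z') i j *: w.
  move=> Ed [|[|i]] j; rewrite /affine -/(affine x' y' z') /co.
  - rewrite scalerDl actDr // -scalerA !actZr // (act_dr actP) Ed.
    rewrite !scalerDl -!scalerA scalerDl -!scalerA; congr (_ *: (_ + _) + _).
    by case: j => [|j] /=; rewrite ?scale0r // Ed.
  - by rewrite actZr // Ed scalerA.
  - by rewrite !scale0r act0r.
rewrite Eb Ea' (comp _ _ _ _ _ _ _ _ Ea) (comp _ _ _ _ _ _ _ _ Eb').
have -> : bracket_act br act a b v m n =
  ((- x5%:P * ml (affine x6 y6 z6) (m + n)%N + z5%:P * affine x6 y6 z6 (m + n))
     *+ 'C(m + n, n) +
   (if m is m'.+1 then y5%:P * affine x6 y6 z6 (m' + n) *+ 'C(m' + n, n) else 0))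
  *: w.
  have E0 l : act (affine x5 y5 z5 0 *: c) l v =
      (- x5%:P * ml (affine x6 y6 z6) l + z5%:P * affine x6 y6 z6 l) *: w.
    rewrite /affine -/(affine x6 y6 z6) scalerDl actDl // -scalerA !actZl //.
    rewrite (act_dl actP) Ec scalerDl -!scalerA; congr (_ + _).
    rewrite scalerN scaleNr; congr (- (_ *: _)).
    by case: l => [|l] /=; rewrite ?scale0r // Ec.
  rewrite /bracket_act big_ord_recl /= subn0 Ebr E0 [RHS]scalerDl scalerMnl.
  congr (_ + _); case: m => [|m]; first by rewrite big_ord0 scale0r.
  rewrite big_ord_recl /= big1 => [|k _]; last by rewrite Ebr scale0r act0l // mul0rn.
  rewrite addr0 Ebr actZl // Ec subSS subn0 scalerA.
  by rewrite scalerMnl.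
rewrite -scalerBl; congr (_ *: w); apply/eqP; rewrite -subr_eq0; apply/eqP.
pose E1 := x1 * x2 - x3 * x4.
pose E2 := x1 * x2 + x1 * y2 - x4 * y3 - (y5 - x5) * x6.
pose E3 := y1 * x2 - x3 * x4 - x3 * y4 + x5 * x6.
pose E4 := x1 * y2 - (y5 - x5) * y6.
pose E5 := y1 * y2 - y3 * y4 - ((y5 - x5) * y6 - x5 * y6).
pose E6 := - x3 * y4 + x5 * y6.
pose E7 := x1 * z2 + z1 * x2 - x3 * z4 - z3 * x4 - z5 * x6.
pose E8 := x1 * z2 + z1 * y2 - y3 * z4 - ((y5 - x5) * z6 + z5 * y6).
pose E9 := y1 * z2 - x3 * z4 - z3 * y4 - (- x5 * z6 + z5 * y6).
pose E10 := z1 * z2 - z3 * z4 - z5 * z6.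
have {}e1 : E1%:P = 0 by rewrite /E1 e1 subrr.
have {}e2 : E2%:P = 0 by rewrite /E2 e2 subrr.
have {}e3 : E3%:P = 0 by rewrite /E3 e3 mulNr addNr.
have {}e4 : E4%:P = 0 by rewrite /E4 e4 subrr.
have {}e5 : E5%:P = 0 by rewrite /E5 e5 subrr.
have {}e6 : E6%:P = 0 by rewrite /E6 e6 mulNr addNr.
have {}e7 : E7%:P = 0 by rewrite /E7 e7 subrr.
have {}e8 : E8%:P = 0 by rewrite /E8 e8 subrr.
have {}e9 : E9%:P = 0 by rewrite /E9 e9 subrr.
have {}e10 : E10%:P = 0 by rewrite /E10 e10 subrr.
case: m n => [|[|[|m]]] [|[|[|n]]];
  rewrite ?addn0 ?add0n ?addnS ?addSn /= ?bin0 ?binn ?mulr1n ?mulr0 ?mul0rn ?addr0 ?subr0 ?sub0r ?mulr0 ?mul0rn ?oppr0 //.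
- transitivity (E1%:P * 'X ^+ 2 + E7%:P * 'X + E10%:P).
    by rewrite /E1 /E7 /E10 !(polyCD, polyCN, polyCM); ring.
  by rewrite e1 e7 e10 !mul0r !addr0.
- transitivity (E3%:P * 'X + E9%:P); first by rewrite /E3 /E9 !(polyCD, polyCN, polyCM); ring.
  by rewrite e3 e9 mul0r addr0.
- by transitivity (E6%:P); first by rewrite /E6 !(polyCD, polyCN, polyCM); ring.
- transitivity (E2%:P * 'X + E8%:P); first by rewrite /E2 /E8 !(polyCD, polyCN, polyCM); ring.
  by rewrite e2 e8 mul0r addr0.
- by rewrite bin1 addn0; transitivity (E5%:P); first by rewrite /E5 !(polyCD, polyCN, polyCM); ring.
- by transitivity (E4%:P); first by rewrite /E4 !(polyCD, polyCN, polyCM); ring.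
Qed.

End Jacobi.
End Extension.

(* C[d,lambda] is {poly {poly C}}: the inner variable is d, the outer one
   lambda. *)
Local Notation C2 := {poly {poly C}}.

Definition dd : C2 := 'X%:P.
Definition lambda : C2 := 'X.
Definition scal (x : C) : C2 := x%:P%:P.

(* f(q), for f in C[d] and q in C[d,lambda] *)
Definition eval_at (f : {poly C}) (q : C2) : C2 := (map_poly scal f).[q].

(* Coefficient of lambda^n in f(- lambda) g(d + lambda) q(d, lambda), where
   [(f(d) e)_lambda (g(d) e')] = f(- lambda) g(d + lambda) q(d, lambda) e''
   whenever [e_lambda e'] = q(d, lambda) e''. *)
Definition sesq (q : C2) (f g : {poly C}) (n : nat) : {poly C} :=
  (eval_at f (- lambda) * eval_at g (dd + lambda) * q)`_n.

Section Sesq.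
Let scalE : scal = polyC \o polyC. Proof. by []. Qed.

Lemma eval_atD f g q : eval_at (f + g) q = eval_at f q + eval_at g q.
Proof. by rewrite /eval_at scalE rmorphD hornerD. Qed.
Lemma eval_at0 q : eval_at 0 q = 0.
Proof. by rewrite /eval_at scalE rmorph0 horner0. Qed.
Lemma eval_atZ c f q : eval_at (c%:P * f) q = scal c * eval_at f q.
Proof. by rewrite /eval_at scalE rmorphM /= map_polyC hornerM hornerC. Qed.
Lemma eval_atX f q : eval_at ('X * f) q = q * eval_at f q.
Proof. by rewrite /eval_at scalE rmorphM /= map_polyX hornerM hornerX. Qed.
Lemma eval_at1 q : eval_at 1 q = 1.
Proof. by rewrite /eval_at scalE rmorph1 hornerC. Qed.

Variable q : C2.

Lemma sesq_linl c f f' g n :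
  sesq q (c%:P * f + f') g n = c%:P * sesq q f g n + sesq q f' g n.
Proof. by rewrite /sesq eval_atD eval_atZ !mulrDl coefD -!mulrA coefCM. Qed.
Lemma sesq_linr c f g g' n :
  sesq q f (c%:P * g + g') n = c%:P * sesq q f g n + sesq q f g' n.
Proof.
by rewrite /sesq eval_atD eval_atZ mulrDr mulrDl coefD mulrCA -!mulrA coefCM.
Qed.
Lemma sesq0l g n : sesq q 0 g n = 0.
Proof. by rewrite /sesq eval_at0 !mul0r coef0. Qed.
Lemma sesq0r f n : sesq q f 0 n = 0.
Proof. by rewrite /sesq eval_at0 mulr0 mul0r coef0. Qed.
Lemma sesq_Xl f g n :
  sesq q ('X * f) g n = - (if n is n'.+1 then sesq q f g n' else 0).
Proof.
by rewrite /sesq eval_atX -!mulrA mulNr coefN coefXM; case: n.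
Qed.
Lemma sesq_Xr f g n : sesq q f ('X * g) n =
  'X * sesq q f g n + (if n is n'.+1 then sesq q f g n' else 0).
Proof.
rewrite /sesq eval_atX mulrCA -!mulrA [_ * (eval_at g _ * _)]mulrA.
by rewrite mulrDl coefD coefCM coefXM -!mulrA; case: n.
Qed.
Lemma sesq_finite f g n :
  (size (eval_at f (- lambda) * eval_at g (dd + lambda) * q)%R <= n)%N ->
  sesq q f g n = 0.
Proof. exact: nth_default. Qed.
Lemma sesq11 n : sesq q 1 1 n = q`_n.
Proof. by rewrite /sesq !eval_at1 !mul1r. Qed.
End Sesq.

(* The free C[d]-module with basis (e_i)_(i >= 0) is [{poly {poly C}}], with
   e_i = 'X^i.  Given [e_i _lambda e_j] = q i j e_(i+j), this is the coefficient
   of lambda^n in [a_lambda b]. *)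
Definition graded_act (q : nat -> nat -> C2) (a : {poly {poly C}}) (n : nat)
    (b : {poly {poly C}}) : {poly {poly C}} :=
  \sum_(i < size a) \sum_(j < size b)
     sesq (q i j) a`_i b`_j n *: 'X^(i + j).

(* The same for an action (e_i)_lambda v = l i v on C[d]v, with v = 1;
   {poly C}^o is {poly C} as a module over itself. *)
Definition rank1_act (l : nat -> C2) (a : {poly {poly C}}) (n : nat)
    (g : {poly C}^o) : {poly C}^o :=
  \sum_(i < size a) sesq (l i) a`_i g n.

Lemma sum_widen (V : zmodType) (F : nat -> V) n N :
  (n <= N)%N -> (forall i, (n <= i)%N -> F i = 0) ->
  \sum_(i < n) F i = \sum_(i < N) F i.
Proof.
move=> nN F0; rewrite -!(big_mkord xpredT) (big_cat_nat (leq0n n) nN) /=.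
by rewrite [X in _ + X]big_nat_cond [X in _ + X]big1 ?addr0 // => i /andP[/andP[/F0]].
Qed.

Lemma graded_actE q (a : C2) n (b : C2) N : (size a <= N)%N -> (size b <= N)%N ->
  graded_act q a n b =
    \sum_(i < N) \sum_(j < N) sesq (q i j) a`_i b`_j n *: 'X^(i + j).
Proof.
move=> aN bN; rewrite /graded_act.
rewrite (@sum_widen _ (fun i => \sum_(j < size b)
  sesq (q i j) a`_i b`_j n *: 'X^(i + j)) _ N) //.
  apply: eq_bigr => i _; apply: (@sum_widen _ (fun j => 
    sesq (q i j) a`_i b`_j n *: 'X^(i + j))) => // j jb.
  by rewrite [b`_j]nth_default // sesq0r scale0r.
move=> i ia; rewrite big1 // => j _.
by rewrite [a`_i]nth_default // sesq0l scale0r.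
Qed.

Lemma rank1_actE l (a : C2) n g N : (size a <= N)%N ->
  rank1_act l a n g = \sum_(i < N) sesq (l i) a`_i g n.
Proof.
move=> aN; apply: (@sum_widen _ (fun i => sesq (l i) a`_i g n)) => // i ia.
by rewrite [a`_i]nth_default // sesq0l.
Qed.

Lemma graded_actP q : lambda_action (graded_act q).
Proof.
pose mx (s : seq nat) := foldr maxn 0%N s.
have le_mx (s : seq nat) x : x \in s -> (x <= mx s)%N.
  elim: s => //= y s IH; rewrite inE => /orP[/eqP->|/IH]; first exact: leq_maxl.
  by move=> h; rewrite (leq_trans h) // leq_maxr.
split.
- move=> a b; exists (\max_(i < size a) \max_(j < size b)
    size (eval_at a`_i (- lambda) * eval_at b`_j (dd + lambda) * q i j)%R).
  move=> n /bigmax_leqP nN; rewrite /graded_act big1 // => i _; rewrite big1 // => j _.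
  have /bigmax_leqP/(_ j isT) := nN i isT.
  by move=> h; rewrite sesq_finite // scale0r.
- move=> c a a' n b.
  pose N := mx [:: size (c%:P *: a + a'); size a; size a'; size b].
  rewrite 3?(@graded_actE _ _ _ _ N) ?le_mx ?inE ?eqxx ?orbT //.
  rewrite scaler_sumr -big_split; apply: eq_bigr => i _ /=.
  rewrite scaler_sumr -big_split; apply: eq_bigr => j _ /=.
  by rewrite coefD coefZ sesq_linl scalerDl scalerA.
- move=> c a n b b'.
  pose N := mx [:: size (c%:P *: b + b'); size b; size b'; size a].
  rewrite 3?(@graded_actE _ _ _ _ N) ?le_mx ?inE ?eqxx ?orbT //.
  rewrite scaler_sumr -big_split; apply: eq_bigr => i _ /=.
  rewrite scaler_sumr -big_split; apply: eq_bigr => j _ /=.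
  by rewrite coefD coefZ sesq_linr scalerDl scalerA.
- move=> a n b.
  pose N := mx [:: size ('X *: a); size a; size b].
  rewrite (@graded_actE _ _ _ _ N) ?le_mx ?inE ?eqxx ?orbT //.
  have -> : mul_lambda ((graded_act q a) ^~ b) n = \sum_(i < N) \sum_(j < N)
      (if n is n'.+1 then sesq (q i j) a`_i b`_j n' else 0) *: 'X^(i + j).
    case: n => [|n] /=.
      by rewrite big1 // => i _; rewrite big1 // => j _; rewrite scale0r.
    by rewrite (@graded_actE _ _ _ _ N) ?le_mx ?inE ?eqxx ?orbT.
  rewrite -sumrN; apply: eq_bigr => i _; rewrite -sumrN; apply: eq_bigr => j _.
  by rewrite coefZ sesq_Xl scaleNr.
- move=> a n b.
  pose N := mx [:: size ('X *: b); size a; size b].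
  rewrite 2?(@graded_actE _ _ _ _ N) ?le_mx ?inE ?eqxx ?orbT //.
  have -> : mul_lambda ((graded_act q a) ^~ b) n = \sum_(i < N) \sum_(j < N)
      (if n is n'.+1 then sesq (q i j) a`_i b`_j n' else 0) *: 'X^(i + j).
    case: n => [|n] /=.
      by rewrite big1 // => i _; rewrite big1 // => j _; rewrite scale0r.
    by rewrite (@graded_actE _ _ _ _ N) ?le_mx ?inE ?eqxx ?orbT.
  rewrite scaler_sumr -big_split; apply: eq_bigr => i _ /=.
  rewrite scaler_sumr -big_split; apply: eq_bigr => j _ /=.
  by rewrite coefZ sesq_Xr scalerDl scalerA.
Qed.

Lemma rank1_actP l : lambda_action (rank1_act l).
Proof.
split.
- move=> a g; exists (\max_(i < size a)
    size (eval_at a`_i (- lambda) * eval_at g (dd + lambda) * l i)%R).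
  move=> n /bigmax_leqP nN; rewrite /rank1_act big1 // => i _.
  by rewrite sesq_finite // nN.
- move=> c a a' n g.
  pose N := maxn (size (c%:P *: a + a')) (maxn (size a) (size a')).
  rewrite 3?(@rank1_actE _ _ _ _ N) ?leq_max ?leqnn ?orbT //.
  rewrite scaler_sumr -big_split; apply: eq_bigr => i _ /=.
  by rewrite coefD coefZ sesq_linl.
- move=> c a n g g'; rewrite /rank1_act scaler_sumr -big_split.
  by apply: eq_bigr => i _ /=; rewrite sesq_linr.
- move=> a n g; pose N := maxn (size ('X *: a)) (size a).
  rewrite (@rank1_actE _ _ _ _ N) ?leq_max ?leqnn ?orbT //.
  have -> : mul_lambda ((rank1_act l a) ^~ g) n = \sum_(i < N)
      (if n is n'.+1 then sesq (l i) a`_i g n' else 0).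
    case: n => [|n] /=; first by rewrite big1.
    by rewrite (@rank1_actE _ _ _ _ N) ?leq_max ?leqnn ?orbT.
  by rewrite -sumrN; apply: eq_bigr => i _; rewrite coefZ sesq_Xl.
- move=> a n g.
  have -> : mul_lambda ((rank1_act l a) ^~ g) n = \sum_(i < size a)
      (if n is n'.+1 then sesq (l i) a`_i g n' else 0).
    by case: n => [|n] //=; rewrite big1.
  rewrite /rank1_act scaler_sumr -big_split.
  by apply: eq_bigr => i _ /=; rewrite sesq_Xr.
Qed.

Lemma graded_act_gen q i j n :
  graded_act q 'X^i n 'X^j = (q i j)`_n *: 'X^(i + j).
Proof.
rewrite /graded_act !size_polyXn big_ord_recr /= [X in X + _]big1 ?add0r.
  rewrite big_ord_recr /= big1 ?add0r => [|k _]; last first.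
    by rewrite !coefXn (ltn_eqF (ltn_ord k)) sesq0r scale0r.
  by rewrite !coefXn !eqxx sesq11.
move=> k _; rewrite big1 // => k' _.
by rewrite !coefXn (ltn_eqF (ltn_ord k)) sesq0l scale0r.
Qed.

Lemma rank1_act_gen l i n : rank1_act l 'X^i n 1 = (l i)`_n.
Proof.
rewrite /rank1_act !size_polyXn big_ord_recr /= big1 ?add0r => [|k _].
  by rewrite coefXn eqxx sesq11.
by rewrite coefXn (ltn_eqF (ltn_ord k)) sesq0l.
Qed.

Lemma coef_affine x y z n :
  (scal x * dd + scal y * lambda + scal z)`_n = affine x y z n.
Proof.
rewrite /scal /dd /lambda -rmorphM /= !coefD !coefC coefCM coefX.
by case: n => [|[|n]]; rewrite /= ?mulr0 ?mulr1 ?addr0 ?add0r.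
Qed.

Section Skew.
Variables (A : lmodType {poly C}) (br : A -> nat -> A -> A).
Hypothesis brP : lambda_action br.

Lemma subst_skew_widen (u : nat -> A) N N' n :
  (forall k, (N <= k)%N -> u k = 0) -> (N <= N')%N ->
  subst_skew N u n = subst_skew N' u n.
Proof.
move=> u0 NN'; rewrite /subst_skew.
apply: (sum_widen (F := fun k : nat =>
  ((-1) ^+ k * 'X ^+ (k - n) *+ 'C(k, n)) *: u k)) => // k /u0->.
by rewrite scaler0.
Qed.

Lemma subst_skew_lin c (u u' : nat -> A) N n :
  subst_skew N (fun k => c%:P *: u k + u' k) n =
    c%:P *: subst_skew N u n + subst_skew N u' n.
Proof.
rewrite /subst_skew scaler_sumr -big_split; apply: eq_bigr => k _ /=.
by rewrite scalerDr !scalerA mulrC.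
Qed.

Definition skew a b := exists N, (forall n, (N <= n)%N -> br b n a = 0) /\
  forall n, br a n b = - subst_skew N (br b ^~ a) n.

Lemma skewP a b : skew a b -> forall N, (forall n, (N <= n)%N -> br b n a = 0) ->
  forall n, br a n b = - subst_skew N (br b ^~ a) n.
Proof.
move=> [N0 [H0 E]] N H n; rewrite E; congr (- _).
rewrite (@subst_skew_widen (br b ^~ a) N0 (maxn N0 N)) ?leq_maxl //.
by rewrite (@subst_skew_widen (br b ^~ a) N (maxn N0 N)) ?leq_maxr.
Qed.

Lemma skew_linl c a a' b : skew a b -> skew a' b -> skew (c%:P *: a + a') b.
Proof.
move=> [N [H E]] [N' [H' E']]; exists (maxn N N'); split.
  move=> n; rewrite geq_max => /andP[/H e /H' e'].
  by rewrite (act_linr brP) e e' scaler0 addr0.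
move=> n; have -> : br b ^~ (c%:P *: a + a') = fun k => c%:P *: br b k a + br b k a'.
  by apply: funext => k; rewrite (act_linr brP).
rewrite subst_skew_lin (act_linl brP) E E'.
rewrite (@subst_skew_widen (br b ^~ a) N (maxn N N')) ?leq_maxl //.
rewrite (@subst_skew_widen (br b ^~ a') N' (maxn N N')) ?leq_maxr //.
by rewrite scalerN opprD.
Qed.

Lemma skew_linr c a b b' : skew a b -> skew a b' -> skew a (c%:P *: b + b').
Proof.
move=> [N [H E]] [N' [H' E']]; exists (maxn N N'); split.
  move=> n; rewrite geq_max => /andP[/H e /H' e'].
  by rewrite (act_linl brP) e e' scaler0 addr0.
move=> n; have -> : br (c%:P *: b + b') ^~ a = fun k => c%:P *: br b k a + br b' k a.
  by apply: funext => k; rewrite (act_linl brP).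
rewrite subst_skew_lin (act_linr brP) E E'.
rewrite (@subst_skew_widen (br b ^~ a) N (maxn N N')) ?leq_maxl //.
rewrite (@subst_skew_widen (br b' ^~ a) N' (maxn N N')) ?leq_maxr //.
by rewrite scalerN opprD.
Qed.

Lemma subst_skew_mul (u : nat -> A) N n :
  subst_skew N.+1 (mul_lambda u) n =
  - 'X *: subst_skew N u n - mul_lambda (subst_skew N u) n.
Proof.
rewrite /subst_skew big_ord_recl /= scaler0 add0r.
case: n => [|n] /=.
  rewrite subr0 scaler_sumr; apply: eq_bigr => k _.
  by rewrite scalerA !bin0 !mulr1n !subn0 /bump /= add1n !exprS; congr (_ *: _); ring.
rewrite scaler_sumr -sumrN -big_split; apply: eq_bigr => k _ /=.
rewrite -scaleNr scalerA -scalerDl; congr (_ *: _).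
rewrite /bump /= add1n subSS binS mulrnDr exprS -!mulrA !mulN1r mulNrn mulNrn.
congr (_ - _); have [kn|nk] := leqP k n; first by rewrite bin_small // !mulr0n mulr0 oppr0.
have -> : (k - n = (k - n.+1).+1)%N by rewrite subnSK.
by rewrite [in LHS]exprS mulNr mulrCA -!mulrnAr.
Qed.

Lemma skew_Xl a b : skew a b -> skew ('X *: a) b.
Proof.
move=> [N [H E]]; exists N.+1; split.
  move=> n Nn; rewrite (act_dr brP) H ?(ltnW Nn) // scaler0 add0r.
  by case: n Nn => //= n; exact: H.
move=> n; have -> : br b ^~ ('X *: a) =
    fun k => 'X *: br b k a + mul_lambda (br b ^~ a) k.
  by apply: funext => k; rewrite (act_dr brP).
have -> : subst_skew N.+1 (fun k => 'X *: br b k a + mul_lambda (br b ^~ a) k) n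
  = 'X *: subst_skew N.+1 (br b ^~ a) n + subst_skew N.+1 (mul_lambda (br b ^~ a)) n.
  rewrite /subst_skew scaler_sumr -big_split; apply: eq_bigr => k _ /=.
  by rewrite scalerDr !scalerA [X in X *: _]mulrC.
rewrite subst_skew_mul -(@subst_skew_widen _ N N.+1) //.
rewrite scaleNr addrA subrr sub0r opprK (act_dl brP).
by case: n => [|n] /=; rewrite ?oppr0 // E opprK.
Qed.

Lemma skew_Xr a b : skew a b -> skew a ('X *: b).
Proof.
move=> [N [H E]]; exists N.+1; split.
  move=> n Nn; rewrite (act_dl brP).
  by case: n Nn => //= n /H->; rewrite oppr0.
move=> n; have -> : br ('X *: b) ^~ a = fun k => (-1)%:P *: mul_lambda (br b ^~ a) k + 0.
  by apply: funext => k; rewrite (act_dl brP) polyCN scaleN1r addr0.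
rewrite subst_skew_lin subst_skew_mul (act_dr brP) E polyCN scaleN1r.
have -> : subst_skew N.+1 (fun=> 0 : A) n = 0.
  by rewrite /subst_skew big1 // => k _; rewrite scaler0.
rewrite addr0 opprK scaleNr scalerN; congr (_ + _).
by case: n => [|n] /=; rewrite ?oppr0 // E.
Qed.

Lemma skew_affine a b c x y z x' y' z' :
  (forall n, br a n b = affine x y z n *: c) ->
  (forall n, br b n a = affine x' y' z' n *: c) ->
  [/\ x = y' - x', y = y' & z = - z'] -> skew a b.
Proof.
move=> E E' [hx hy hz]; subst x y z; exists 2; split.
  by move=> [|[|n]] // _; rewrite E' scale0r.
move=> n; rewrite E /subst_skew !big_ord_recl big_ord0 /= !E' addr0 !scalerA.
rewrite -scalerDl -scaleNr; congr (_ *: _).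
case: n => [|[|n]] /=; rewrite ?bin0 ?binn ?bin_small //= ?subn0 ?subnn.
- by rewrite !polyCD !polyCN; ring.
- by rewrite ?expr0 ?expr1; ring.
- by rewrite !mulr0n; ring.
Qed.
End Skew.

Section AlgebraB.
Variables (alpha beta p : C).

Definition bLL (i j : nat) : C2 :=
  scal (i%:R + p) * dd + scal (i%:R + j%:R + 2 * p) * lambda.
Definition bLW (i j : nat) : C2 :=
  scal (i%:R + p) * (dd + scal beta) + scal (i%:R + j%:R + alpha) * lambda.
(* [W_j _lambda L_i], i.e. - bLW i j at - lambda - d *)
Definition bWL (j i : nat) : C2 :=
  - (scal (i%:R + p) * (dd + scal beta)
     + scal (i%:R + j%:R + alpha) * (- lambda - dd)).

(* (a, w) stands for \sum_i a_i L_i + \sum_i w_i W_i with a_i, w_i in C[d] *)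
Definition Bsort : lmodType {poly C} := ({poly {poly C}} * {poly {poly C}})%type.
Definition BL (i : nat) : Bsort := ('X^i, 0).
Definition BW (i : nat) : Bsort := (0, 'X^i).

Definition Bbr (x : Bsort) (n : nat) (y : Bsort) : Bsort :=
  (graded_act bLL x.1 n y.1,
   graded_act bLW x.1 n y.2 + graded_act bWL x.2 n y.1).

Lemma Bbr_LL i j n : Bbr (BL i) n (BL j) = (bLL i j)`_n *: BL (i + j).
Proof.
rewrite /Bbr /= graded_act_gen (act0r (graded_actP _)) (act0l (graded_actP _)) addr0.
by apply/eqP/andP; split; rewrite //= scaler0.
Qed.
Lemma Bbr_LW i j n : Bbr (BL i) n (BW j) = (bLW i j)`_n *: BW (i + j).
Proof.
rewrite /Bbr /= graded_act_gen (act0r (graded_actP _)) (act0l (graded_actP _)) addr0.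
by apply/eqP/andP; split; rewrite //= scaler0.
Qed.
Lemma Bbr_WL i j n : Bbr (BW j) n (BL i) = (bWL j i)`_n *: BW (j + i).
Proof.
rewrite /Bbr /= graded_act_gen (act0r (graded_actP _)) (act0l (graded_actP _)) add0r.
by apply/eqP/andP; split; rewrite //= scaler0.
Qed.
Lemma Bbr_WW i j n : Bbr (BW i) n (BW j) = 0.
Proof.
by rewrite /Bbr /= !(act0r (graded_actP _)) !(act0l (graded_actP _)) addr0.
Qed.

Lemma BbrP : lambda_action Bbr.
Proof.
have [f1 ll1 lr1 dl1 dr1] := graded_actP bLL.
have [f2 ll2 lr2 dl2 dr2] := graded_actP bLW.
have [f3 ll3 lr3 dl3 dr3] := graded_actP bWL.
have pairP (u v : Bsort) : u.1 = v.1 -> u.2 = v.2 -> u = v.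
  by case: u v => [? ?] [? ?] /= -> ->.
split.
- move=> x y; have [N1 H1] := f1 x.1 y.1; have [N2 H2] := f2 x.1 y.2.
  have [N3 H3] := f3 x.2 y.1; exists (maxn N1 (maxn N2 N3)) => n.
  rewrite !geq_max => /and3P[/H1 e1 /H2 e2 /H3 e3].
  by rewrite /Bbr e1 e2 e3 addr0.
- move=> c x x' n y; apply: pairP; rewrite /= ?ll1 // ll2 ll3.
  by rewrite scalerDr addrACA.
- move=> c x n y y'; apply: pairP; rewrite /= ?lr1 // lr2 lr3.
  by rewrite scalerDr addrACA.
- move=> x n y; apply: pairP; rewrite /= ?dl1 ?dl2 ?dl3 -?opprD;
    by case: n => [|n] /=; rewrite ?addr0.
- move=> x n y; apply: pairP; rewrite /= ?dr1 ?dr2 ?dr3;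
    case: n => [|n] /=; rewrite ?addr0 ?scalerDr //.
  by rewrite addrACA.
Qed.

Lemma Bspan (P : Bsort -> Prop) :
  (forall c u v, P u -> P v -> P (c%:P *: u + v)) ->
  (forall u, P u -> P ('X *: u)) ->
  (forall i, P (BL i)) -> (forall i, P (BW i)) -> forall x, P x.
Proof.
move=> Plin PX PL PW x.
have PD u v : P u -> P v -> P (u + v).
  by move=> Pu Pv; rewrite -[u]scale1r; apply: (Plin 1).
have P0 : P 0 by have := Plin (-1) _ _ (PL 0) (PL 0); rewrite polyCN scaleN1r addNr.
have -> : x = \sum_(i < size x.1) x.1`_i *: BL i + \sum_(i < size x.2) x.2`_i *: BW i.
  have fst_sum m (F : 'I_m -> Bsort) : (\sum_i F i).1 = \sum_i (F i).1.
    exact: (big_morph fst).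
  have snd_sum m (F : 'I_m -> Bsort) : (\sum_i F i).2 = \sum_i (F i).2.
    exact: (big_morph snd).
  case: x => a w; apply/eqP/andP; split; rewrite /= ?fst_sum ?snd_sum /=.
    rewrite [X in _ + X]big1 ?addr0 => [|i _]; last exact: scaler0.
    by rewrite -poly_def coefK.
  rewrite [X in X + _]big1 ?add0r => [|i _]; last exact: scaler0.
  by rewrite -poly_def coefK.
by apply: (PD); apply: (big_ind P P0 PD) => i _; apply: act_span.
Qed.

Lemma affLL i j n : (bLL i j)`_n = affine (i%:R + p) (i%:R + j%:R + 2 * p) 0 n.
Proof. by rewrite -coef_affine /scal polyC0 addr0. Qed.
Lemma affLW i j n : (bLW i j)`_n =
  affine (i%:R + p) (i%:R + j%:R + alpha) ((i%:R + p) * beta) n.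
Proof.
by rewrite -coef_affine /bLW mulrDr addrAC /scal !polyCM.
Qed.
Lemma affWL j i n : (bWL j i)`_n =
  affine (j%:R + alpha - p) (i%:R + j%:R + alpha) (- ((i%:R + p) * beta)) n.
Proof.
rewrite -coef_affine /bWL; congr (polyseq _)`_n.
by rewrite /scal !(polyCD, polyCN, polyCM); ring.
Qed.

Lemma Bskew a b : skew Bbr a b.
Proof.
move: a b; apply: (@Bspan (fun a => forall b, skew Bbr a b)).
- move=> c u v Hu Hv b; exact: (skew_linl BbrP c (Hu b) (Hv b)).
- move=> u Hu b; exact: (skew_Xl BbrP (Hu b)).
- move=> i; apply: (@Bspan (fun b => skew Bbr (BL i) b)) => [c u v|u|j|j].
  + exact: (skew_linr BbrP).
  + exact: (skew_Xr BbrP).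
  + apply: (@skew_affine _ Bbr _ _ (BL (i + j))) => [n|n|].
    * by rewrite Bbr_LL affLL.
    * by rewrite Bbr_LL affLL addnC.
    * by split; ring.
  + apply: (@skew_affine _ Bbr _ _ (BW (i + j))) => [n|n|].
    * by rewrite Bbr_LW affLW.
    * by rewrite Bbr_WL affWL addnC.
    * by split; ring.
- move=> i; apply: (@Bspan (fun b => skew Bbr (BW i) b)) => [c u v|u|j|j].
  + exact: (skew_linr BbrP).
  + exact: (skew_Xr BbrP).
  + apply: (@skew_affine _ Bbr _ _ (BW (i + j))) => [n|n|].
    * by rewrite Bbr_WL affWL.
    * by rewrite Bbr_LW affLW addnC.
    * by split; ring.
  + apply: (@skew_affine _ Bbr _ _ 0 0 0 0 0 0 0) => [n|n|].
    * by rewrite Bbr_WW scaler0.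
    * by rewrite Bbr_WW scaler0.
    * by split; ring.
Qed.

Lemma Bjacobi_gen (M : lmodType {poly C}) (act : Bsort -> nat -> M -> M) v :
  lambda_action act ->
  (forall i j, jacobi Bbr act (BL i) (BL j) v) ->
  (forall i j, jacobi Bbr act (BL i) (BW j) v) ->
  (forall i j, jacobi Bbr act (BW i) (BL j) v) ->
  (forall i j, jacobi Bbr act (BW i) (BW j) v) ->
  forall a b, jacobi Bbr act a b v.
Proof.
move=> actP JLL JLW JWL JWW; apply: (@Bspan (fun a => forall b, jacobi Bbr act a b v)) => [c u u' Hu Hu' b|u Hu b|i|i].
- exact: (jacobi_linl BbrP actP).
- exact: (jacobi_Xl BbrP actP).
- apply: (@Bspan (fun b => jacobi Bbr act (BL i) b v)) => // [c u u'|u].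
  + exact: (jacobi_linm BbrP actP).
  + exact: (jacobi_Xm BbrP actP).
- apply: (@Bspan (fun b => jacobi Bbr act (BW i) b v)) => // [c u u'|u].
  + exact: (jacobi_linm BbrP actP).
  + exact: (jacobi_Xm BbrP actP).
Qed.

Lemma Bjacobi a b c : jacobi Bbr Bbr a b c.
Proof.
move: c a b; apply: (@Bspan (fun c => forall a b, jacobi Bbr Bbr a b c)) => [k u v Hu Hv a b|u Hu a b|k|k].
- exact: (jacobi_linr BbrP k (Hu a b) (Hv a b)).
- exact: (jacobi_Xr BbrP (Hu a b)).
- apply: Bjacobi_gen (BbrP) _ _ _ _ => i j.
  + apply: (@jacobi_affine _ _ _ _ BbrP _ _ (BL (i + j)) _ (BL (j + k))
      (BL (i + k)) (BL (i + j + k))) => [n|n|n|n|n|n||].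
    * by rewrite Bbr_LL affLL.
    * by rewrite Bbr_LL affLL addnA.
    * by rewrite Bbr_LL affLL.
    * by rewrite Bbr_LL affLL addnCA addnA.
    * by rewrite Bbr_LL affLL.
    * by rewrite Bbr_LL affLL.
    * by rewrite !natrD; split; ring.
    * by rewrite !natrD; split; ring.
  + apply: (@jacobi_affine _ _ _ _ BbrP _ _ (BW (i + j)) _ (BW (j + k))
      (BL (i + k)) (BW (i + j + k))) => [n|n|n|n|n|n||].
    * by rewrite Bbr_WL affWL.
    * by rewrite Bbr_LW affLW addnA.
    * by rewrite Bbr_LL affLL.
    * by rewrite Bbr_WL affWL addnCA addnA.
    * by rewrite Bbr_LW affLW.
    * by rewrite Bbr_WL affWL.
    * by rewrite !natrD; split; ring.
    * by rewrite !natrD; split; ring.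
  + apply: (@jacobi_affine _ _ _ _ BbrP _ _ (BW (i + j)) _ (BL (j + k))
      (BW (i + k)) (BW (i + j + k))) => [n|n|n|n|n|n||].
    * by rewrite Bbr_LL affLL.
    * by rewrite Bbr_WL affWL addnA.
    * by rewrite Bbr_WL affWL.
    * by rewrite Bbr_LW affLW addnCA addnA.
    * by rewrite Bbr_WL affWL.
    * by rewrite Bbr_WL affWL.
    * by rewrite !natrD; split; ring.
    * by rewrite !natrD; split; ring.
  + apply: (@jacobi_affine _ _ _ _ BbrP _ _ 0 _ (BW (j + k))
      (BW (i + k)) 0 _ _ _ 0 0 0 _ _ _ 0 0 0 0 0 0 0 0 0) => [n|n|n|n|n|n||].
    * by rewrite Bbr_WL affWL.
    * by rewrite Bbr_WW scaler0.
    * by rewrite Bbr_WL affWL.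
    * by rewrite Bbr_WW scaler0.
    * by rewrite Bbr_WW scaler0.
    * by rewrite (act0l BbrP) scaler0.
    * by split; ring.
    * by split; ring.
- apply: Bjacobi_gen (BbrP) _ _ _ _ => i j.
  + apply: (@jacobi_affine _ _ _ _ BbrP _ _ (BL (i + j)) _ (BW (j + k))
      (BW (i + k)) (BW (i + j + k))) => [n|n|n|n|n|n||].
    * by rewrite Bbr_LW affLW.
    * by rewrite Bbr_LW affLW addnA.
    * by rewrite Bbr_LW affLW.
    * by rewrite Bbr_LW affLW addnCA addnA.
    * by rewrite Bbr_LL affLL.
    * by rewrite Bbr_LW affLW.
    * by rewrite !natrD; split; ring.
    * by rewrite !natrD; split; ring.
  + apply: (@jacobi_affine _ _ _ _ BbrP _ _ (BW (i + j)) _ 0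
      (BW (i + k)) 0 0 0 0 0 0 0 _ _ _ 0 0 0 _ _ _ 0 0 0) => [n|n|n|n|n|n||].
    * by rewrite Bbr_WW scaler0.
    * by rewrite (act0r BbrP) scaler0.
    * by rewrite Bbr_LW affLW.
    * by rewrite Bbr_WW scaler0.
    * by rewrite Bbr_LW affLW.
    * by rewrite Bbr_WW scaler0.
    * by split; ring.
    * by split; ring.
  + apply: (@jacobi_affine _ _ _ _ BbrP _ _ (BW (i + j)) _ (BW (j + k))
      0 0 _ _ _ 0 0 0 0 0 0 0 0 0 _ _ _ 0 0 0) => [n|n|n|n|n|n||].
    * by rewrite Bbr_LW affLW.
    * by rewrite Bbr_WW scaler0.
    * by rewrite Bbr_WW scaler0.
    * by rewrite (act0r BbrP) scaler0.
    * by rewrite Bbr_WL affWL.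
    * by rewrite Bbr_WW scaler0.
    * by split; ring.
    * by split; ring.
  + move=> m n; rewrite !Bbr_WW !(act0r BbrP) subrr /bracket_act big1 // => l _.
    by rewrite Bbr_WW (act0l BbrP) mul0rn.
Qed.

Definition B : lieConformalAlgebra :=
  LieConformalAlgebra BbrP (fun a b => skewP (Bskew a b))
    (fun a b c m n => etrans (esym (subrK _ _)) (congr1 (+%R^~ _) (Bjacobi a b c m n))).
End AlgebraB.

Section RankOne.
Variables (alpha beta p a b c d : C).

Definition VL (i : nat) : C2 :=
  match i with
  | 0 => scal p * (dd + scal a * lambda + scal b)
  | 1 => scal c
  | _ => 0
  end.
Definition VW (i : nat) : C2 := if i is 0 then scal d else 0.

Definition Vact (x : B alpha beta p) (n : nat) (g : {poly C}^o) : {poly C}^o :=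
  rank1_act VL x.1 n g + rank1_act VW x.2 n g.

Lemma Vact_L i n : Vact (BL i) n 1 = (VL i)`_n.
Proof. by rewrite /Vact rank1_act_gen (act0l (rank1_actP _)) addr0. Qed.
Lemma Vact_W i n : Vact (BW i) n 1 = (VW i)`_n.
Proof. by rewrite /Vact rank1_act_gen (act0l (rank1_actP _)) add0r. Qed.

Lemma VactP : lambda_action Vact.
Proof.
have [f1 ll1 lr1 dl1 dr1] := rank1_actP VL.
have [f2 ll2 lr2 dl2 dr2] := rank1_actP VW.
split.
- move=> x g; have [N1 H1] := f1 x.1 g; have [N2 H2] := f2 x.2 g.
  exists (maxn N1 N2) => n; rewrite geq_max => /andP[/H1 e1 /H2 e2].
  by rewrite /Vact e1 e2 addr0.
- by move=> k x x' n g; rewrite /Vact /= ll1 ll2 scalerDr addrACA.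
- by move=> k x n g g'; rewrite /Vact lr1 lr2 scalerDr addrACA.
- move=> x n g; rewrite /Vact /= dl1 dl2 -opprD.
  by case: n => [|n] /=; rewrite ?addr0.
- move=> x n g; rewrite /Vact /= dr1 dr2.
  by case: n => [|n] /=; rewrite ?addr0 scalerDr // addrACA.
Qed.

Hypothesis hc : c <> 0 -> p = -1.
Hypothesis hd : d <> 0 -> (alpha, beta) = (p, 0).

Let xL i : C := if i is 0 then p else 0.
Let yL i : C := if i is 0 then p * a else 0.
Let zL i : C := match i with 0 => p * b | 1 => c | _ => 0 end.
Let zW i : C := if i is 0 then d else 0.

Let one : {poly C}^o := (1 : {poly C}).

Let VL_affine i n : Vact (BL i) n one = affine (xL i) (yL i) (zL i) n *: one.
Proof.
rewrite Vact_L [RHS]mulr1 -coef_affine; congr (polyseq _)`_n.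
by case: i => [|[|i]]; rewrite /= /scal ?polyCM ?polyC0; ring.
Qed.

Let VW_affine i n : Vact (BW i) n one = affine 0 0 (zW i) n *: one.
Proof.
rewrite Vact_W [RHS]mulr1 -coef_affine; congr (polyseq _)`_n.
by case: i => [|i]; rewrite /= /scal ?polyC0; ring.
Qed.

Lemma Vjacobi x y g : jacobi (@lbr (B alpha beta p)) Vact x y g.
Proof.
have pc : p * c = - c.
  by have [->|/eqP/hc->] := eqVneq c 0; rewrite ?mulr0 ?oppr0 // mulN1r.
have [ad bd] : alpha * d = p * d /\ beta * d = 0.
  by have [->|/eqP/hd[-> ->]] := eqVneq d 0; rewrite ?mulr0 ?mul0r.
suff J1 : jacobi (@lbr (B alpha beta p)) Vact x y one.
  have -> : g = (g : {poly C}) *: one by rewrite [RHS]mulr1.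
  apply: (act_span (P := jacobi (@lbr (B alpha beta p)) Vact x y)) => //.
    by move=> k u v; apply: (jacobi_linr VactP).
  by move=> u; apply: (jacobi_Xr VactP).
apply: Bjacobi_gen (VactP) _ _ _ _ x y => i j.
- apply: (@jacobi_affine _ _ _ _ VactP _ _ (BL (i + j)) _ _ _ _) => [n|n|n|n|n|n||];
  try exact: VL_affine.
  + by rewrite Bbr_LL affLL.
  + case: i j => [|[|i]] [|[|j]]; rewrite ?add0n ?addn0 ?addSn ?addnS /xL /yL /zL; split; ring: pc.
  + case: i j => [|[|i]] [|[|j]]; rewrite ?add0n ?addn0 ?addSn ?addnS /xL /yL /zL; split; ring: pc.
- apply: (@jacobi_affine _ _ _ _ VactP _ _ (BW (i + j)) _ _ _ _) => [n|n|n|n|n|n||];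
  try exact: VL_affine; try exact: VW_affine.
  + by rewrite Bbr_LW affLW.
  + case: i j => [|[|i]] [|[|j]]; rewrite ?add0n ?addn0 ?addSn ?addnS /xL /yL /zL /zW; split; ring: ad bd.
  + case: i j => [|[|i]] [|[|j]]; rewrite ?add0n ?addn0 ?addSn ?addnS /xL /yL /zL /zW; split; ring: ad bd.
- apply: (@jacobi_affine _ _ _ _ VactP _ _ (BW (i + j)) _ _ _ _) => [n|n|n|n|n|n||];
  try exact: VL_affine; try exact: VW_affine.
  + by rewrite Bbr_WL affWL.
  + case: i j => [|[|i]] [|[|j]]; rewrite ?add0n ?addn0 ?addSn ?addnS /xL /yL /zL /zW; split; ring: ad bd.
  + case: i j => [|[|i]] [|[|j]]; rewrite ?add0n ?addn0 ?addSn ?addnS /xL /yL /zL /zW; split; ring: ad bd.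
- apply: (@jacobi_affine _ _ _ _ VactP _ _ 0 _ _ _ _ _ _ _ _ _ _ _ _ _ _ _ _ 0 0 0 0 0 0)
     => [n|n|n|n|n|n||]; try exact: VW_affine.
  + by rewrite Bbr_WW scaler0.
  + rewrite (act0l VactP).
    by case: n => [|[|n]]; rewrite /= ?mul0r ?addr0 scale0r.
  + by split; ring.
  + by split; ring.
Qed.

(* C[d]v with v = 1, L_0 _lambda v = p (d + a lambda + b) v,
   L_1 _lambda v = c v, W_0 _lambda v = d v, and 0 for the other generators *)
Definition rank1_module : conformalModule (B alpha beta p) :=
  ConformalModule VactP Vjacobi.
End RankOne.

Section Modules.
Variables alpha beta p : C.

Definition V_ab (a b : C) : conformalModule (B alpha beta p) :=
  @rank1_module alpha beta p a b 0 0
    (fun h => False_ind _ (h erefl)) (fun h => False_ind _ (h erefl)).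

Definition V_abd (h : (alpha, beta) = (p, 0)) (a b d : C) :
    conformalModule (B alpha beta p) :=
  @rank1_module alpha beta p a b 0 d (fun h => False_ind _ (h erefl)) (fun=> h).

Definition V_abc (hp : p = -1) (a b c : C) : conformalModule (B alpha beta p) :=
  @rank1_module alpha beta p a b c 0 (fun=> hp) (fun h => False_ind _ (h erefl)).

Definition V_abcd (hp : p = -1) (h : (alpha, beta) = (-1, 0)) (a b c d : C) :
    conformalModule (B alpha beta p) :=
  @rank1_module alpha beta p a b c d (fun=> hp)
    (fun=> etrans h (congr1 (pair^~ 0) (esym hp))).
End Modules.
End Conformal.

(* Main.v *)
(* All four families are rank-one modules C[d]v on which the generators act by
   polynomials q(d, lambda).  For a nonzero g(d)v in a submodule T, the top
   lambda-coefficient of g(d + lambda) q(d, lambda) v is a nonzero multiple of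
   the top lambda-coefficient of q, which therefore lies in T.  If one of a, c,
   d is nonzero, this puts a nonzero constant in T, so T is everything.  If
   a = c = d = 0, it puts d + b in T (d being the derivation), so T contains
   (d + b)V, which is a maximal submodule; multiplication by d + b identifies
   it with the module with a = 1. *)
Require Import Defs.
From HB Require Import structures.
From mathcomp Require Import all_boot all_order all_algebra.
From mathcomp Require Import ring.
From mathcomp Require Import boolp classical_sets reals complex.

Set Implicit Arguments.
Unset Strict Implicit.
Unset Printing Implicit Defensive.

Import GRing.Theory.
Local Open Scope ring_scope.
Local Open Scope classical_set_scope.

(** * Invariance of irreducibility under isomorphism *)

Section Isomorphism.
Variables (C : fieldType) (A : lieConformalAlgebra C).
Implicit Types M N : conformalModule A.

Lemma isomorphic_sym M N : isomorphic M N -> isomorphic N M.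
Proof.
move=> [f [[g fK gK] f_act]].
pose gl := GRing.isLinear.Build {poly C} N M *:%R g (can2_linear fK gK).
pose g' : {linear N -> M} := HB.pack g gl.
exists g'; split; first by exists f.
by move=> a n v; apply: (can_inj fK); rewrite /= f_act !gK.
Qed.

Section Preimage.
Variables (M N : conformalModule A) (f : {linear M -> N}).
Hypothesis f_act : forall a n v, f (lact a n v) = lact a n (f v).
Variable S : submodule N.

Fact preim_sub0 : (f @^-1` S) 0.
Proof. by rewrite /preimage /= linear0; apply: sub0. Qed.
Fact preim_subZD (k : {poly C}) u v :
  (f @^-1` S) u -> (f @^-1` S) v -> (f @^-1` S) (k *: u + v).
Proof. by rewrite /preimage /= linearP; apply: subZD. Qed.
Fact preim_sub_act a n v : (f @^-1` S) v -> (f @^-1` S) (lact a n v).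
Proof. by rewrite /preimage /= f_act; apply: sub_act. Qed.

Definition preim_submodule : submodule M :=
  Submodule preim_sub0 preim_subZD preim_sub_act.
End Preimage.

(** A non-trivial submodule of [N] pulls back along the isomorphism to a non-trivial submodule of
    [M]; surjectivity, in the form [x = f (g x)], keeps the preimage different from 0 and from
    [M]. *)
Lemma irreducible_iso M N : isomorphic M N -> irreducible M -> irreducible N.
Proof.
move=> [f [[g fK gK] f_act]] [[v v0] irrM]; split.
  by exists (f v) => fv0; apply: v0; apply: (can_inj fK); rewrite fv0 linear0.
move=> [S [S0 ST]]; apply: irrM; exists (preim_submodule f_act S); split=> /= E.
- apply: S0; apply/seteqP; split=> x /= => [Sx|->]; last exact: sub0.
  have : (f @^-1` S) (g x) by rewrite /preimage /= gK.
  by rewrite E => /= gx0; rewrite -(gK x) gx0 linear0.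
- apply: ST; apply/seteqP; split=> x //= _.
  have : (f @^-1` S) (g x) by rewrite E.
  by rewrite /preimage /= gK.
Qed.

Lemma irreducible_isoE M N :
  isomorphic M N -> (irreducible M <-> irreducible N).
Proof. by move=> h; split; apply: irreducible_iso => //; exact: isomorphic_sym. Qed.

End Isomorphism.

(** * Leading coefficients in lambda *)

Section RankOneModules.
Variables (C : fieldType) (alpha beta p : C).
Hypothesis p0 : p <> 0.

Lemma eval_at_XD (b : C) g q :
  eval_at (('X + b%:P) * g) q = (q + scal b) * eval_at g q.
Proof. by rewrite mulrDl eval_atD eval_atX eval_atZ mulrDl. Qed.

(** Written as a composition in the outer variable lambda, with the coefficients of [g] lifted to
    constants, the shift falls under the formula for leading coefficients of compositions. *)
Lemma eval_at_shift (g : {poly C}) :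
  eval_at g (dd C + lambda C) = g^:P \Po ('X + 'X%:P).
Proof.
rewrite /eval_at /comp_poly addrC /dd /lambda.
by rewrite -map_poly_comp; congr (_.[_]); apply: eq_map_poly.
Qed.

(** As a polynomial in lambda, the inner argument is monic of degree 1, so the top coefficient of
    [g] survives and is free of the derivation. *)
Lemma lead_coef_shift (g : {poly C}) :
  lead_coef (eval_at g (dd C + lambda C)) = (lead_coef g)%:P.
Proof.
rewrite eval_at_shift lead_coef_comp; last by rewrite size_XaddC.
rewrite lead_coefXaddC expr1n mulr1 lead_coef_map_inj //.
exact: polyC_inj.
Qed.

Lemma lead_coef_VL0 (a b c : C) : a != 0 -> lead_coef (VL p a b c 0) = (p * a)%:P.
Proof.
move=> a0.
have pa0 : p * a != 0 by rewrite mulf_neq0 //; apply/eqP.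
have -> : VL p a b c 0 = (p * a)%:P%:P * 'X + (p%:P * ('X + b%:P))%:P.
  rewrite /= /scal /dd /lambda !polyCM !polyCD !mulrDr mulrA.
  by rewrite addrAC addrC.
rewrite lead_coefDl ?lead_coefMX ?lead_coefC //.
(* The lambda term has size 2, while the rest is constant in lambda, of size at most 1. *)
by rewrite size_mulX ?polyC_eq0 // !size_polyC polyC_eq0 pa0; case: (_ != 0).
Qed.

Lemma VL0_0 (b c : C) : VL p 0 b c 0 = (p%:P * ('X + b%:P))%:P.
Proof. by rewrite /= /scal /dd !polyC0 mul0r addr0 polyCM polyCD. Qed.

(** * Nonzero submodules of a rank-one module *)

Section Submodules.
Variables (a b c d : C).
Variables (hc : c <> 0 -> p = -1) (hd : d <> 0 -> (alpha, beta) = (p, 0)).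
Let V := rank1_module a b hc hd.
Variable T : submodule V.

Lemma submoduleM (f v : {poly C}) : sub_set T v -> sub_set T (f * v).
Proof. by move=> Tv; rewrite -[f * v]addr0; exact: (subZD f Tv (sub0 T)). Qed.

Lemma submodule_full (k : C) : k != 0 -> sub_set T (k%:P : {poly C}) -> T = setT :> set _.
Proof.
move=> k0 Tk; apply/seteqP; split=> v // _.
have -> : v = (v : {poly C}) * k^-1%:P * k%:P.
  by rewrite -mulrA -polyCM mulVf // mulr1.
exact: submoduleM.
Qed.

Lemma submodule_lead_coef : T <> [set 0] :> set _ ->
  forall i, sub_set T (lead_coef (VL p a b c i)) /\ sub_set T (lead_coef (VW d i)).
Proof.
move=> T0 i.
have [g Tg g0] : exists2 g : {poly C}, sub_set T g & g != 0.
  apply: contrapT => nex; apply: T0; apply/seteqP; split=> g /= => [Tg|->].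
    by apply: contrapT => /eqP g0; apply: nex; exists g.
  exact: sub0.
have lead q : lead_coef (eval_at 1 (- lambda C) * eval_at g (dd C + lambda C) * q) =
    (lead_coef g)%:P * lead_coef q.
  by rewrite eval_at1 mul1r lead_coefM lead_coef_shift.
have lg0 : lead_coef g != 0 by rewrite lead_coef_eq0.
have unscale (q : {poly C}) : sub_set T ((lead_coef g)%:P * q) -> sub_set T q.
  move=> /(submoduleM (lead_coef g)^-1%:P).
  by rewrite mulrA -polyCM mulVf // mul1r.
(* A generator has a single nonzero coordinate, equal to 1, so one summand remains. *)
have genl (l : nat -> {poly {poly C}}) n : rank1_act l 'X^i n g = sesq (l i) 1 g n.
  rewrite /rank1_act size_polyXn big_ord_recr /= big1 ?add0r => [|k _].
    by rewrite coefXn eqxx.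
  by rewrite coefXn (ltn_eqF (ltn_ord k)) sesq0l.
(* Here [n] is the lambda-degree of the product (0 if the product vanishes), so the goal is to find
   one coefficient of the action on [g] in [T]. *)
split; apply: unscale; rewrite -lead lead_coefE; set n := _.-1.
- have := sub_act (BL C i : B alpha beta p) n Tg.
  by rewrite /= /Vact genl (act0l (rank1_actP _)) addr0.
- have := sub_act (BW C i : B alpha beta p) n Tg.
  by rewrite /= /Vact genl (act0l (rank1_actP _)) add0r.
Qed.

Lemma submodule_trivial : [\/ a <> 0, c <> 0 | d <> 0] ->
  T <> [set 0] :> set _ -> T = setT :> set _.
Proof.
move=> abc /submodule_lead_coef TL.
case: abc => /eqP k0.
- apply: (@submodule_full (p * a)); first by rewrite mulf_neq0 //; apply/eqP.
  by rewrite -(lead_coef_VL0 b c k0); case: (TL 0%N).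
- by apply: (submodule_full k0); have [] := TL 1%N; rewrite /= lead_coefC.
- by apply: (submodule_full k0); have [_] := TL 0%N; rewrite /= lead_coefC.
Qed.
End Submodules.

(** * The case where a, c and d vanish *)

Lemma Vact_XD (b : C) (x : B alpha beta p) n (g : {poly C}) :
  Vact 0 b 0 0 x n (('X + b%:P) * g) = ('X + b%:P) * Vact 1 b 0 0 x n g.
Proof.
rewrite /Vact mulrDr /rank1_act !mulr_sumr; congr (_ + _); apply: eq_bigr => i _.
  (* For [L_0] both sides carry the factor [p ('X + lambda + b) ('X + b)]: the shift of ['X + b] on
     the left is the polynomial of the module with a = 1 on the right. *)
  rewrite /sesq eval_at_XD [RHS]mulrC -coefMC polyCD -/(dd C) -/(scal b).
  congr (polyseq _)`_n; case: (nat_of_ord i) => [|[|j]] /=;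
  by rewrite /scal ?polyC0 ?polyC1; ring.
rewrite /sesq; case: (nat_of_ord i) => [|j] /=;
by rewrite /scal ?polyC0 !mulr0 coef0 mulr0.
Qed.

(** Only [L_0] acts by a nonzero polynomial, namely [p ('X + b)]. It is constant in lambda, so it
    divides every coefficient. Hence the algebra acts as 0 on the quotient by the multiples of
    ['X + b]. *)
Lemma Vact_0_dvd (b : C) (x : B alpha beta p) n (g : {poly C}) :
  exists h : {poly C}, Vact 0 b 0 0 x n g = ('X + b%:P) * h.
Proof.
have comb (F : nat -> {poly C}) m :
    (forall i, exists h : {poly C}, F i = ('X + b%:P) * h) ->
    exists h, \sum_(i < m) F i = ('X + b%:P) * h.
  move=> H; elim: m => [|m [h IH]]; first by exists 0; rewrite big_ord0 mulr0.
  by have [h' E] := H m; exists (h + h'); rewrite big_ord_recr /= IH E mulrDr.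
have [[|i]|h1 E1] := comb (fun i => sesq (VL p 0 b 0 i) x.1`_i g n) (size x.1).
- rewrite /sesq VL0_0 coefMC; set u := nth _ _ _.
  by exists (p%:P * u); ring.
- by exists 0; rewrite /sesq; case: i => [|i]; rewrite /= /scal ?polyC0 !mulr0 coef0.
have [[|i]|h2 E2] := comb (fun i => sesq (VW 0 i) x.2`_i g n) (size x.2).
- by exists 0; rewrite /sesq /= /scal !polyC0 !mulr0 coef0.
- by exists 0; rewrite /sesq /= !mulr0 coef0.
by exists (h1 + h2); rewrite /Vact mulrDr -E1 -E2.
Qed.

Section UniqueSubmodule.
Variable b : C.
Variables (hc : (0 : C) <> 0 -> p = -1) (hd : (0 : C) <> 0 -> (alpha, beta) = (p, 0)).
Variables (hc' : (0 : C) <> 0 -> p = -1) (hd' : (0 : C) <> 0 -> (alpha, beta) = (p, 0)).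
Let V := rank1_module 0 b hc hd.

Definition XD_set : set V := [set ('X + b%:P) *: v | v in setT].

Fact XD_sub0 : XD_set 0.
Proof. by exists 0 => //; rewrite scaler0. Qed.
Fact XD_subZD (f : {poly C}) u v : XD_set u -> XD_set v -> XD_set (f *: u + v).
Proof.
move=> [u' _ <-] [v' _ <-]; exists (f *: u' + v') => //.
by rewrite scalerDr !scalerA mulrC.
Qed.
Fact XD_sub_act x n v : XD_set v -> XD_set (@lact _ _ V x n v).
Proof. by move=> _; have [h E] := Vact_0_dvd b x n v; exists h. Qed.

Definition XD_submodule : submodule V := Submodule XD_sub0 XD_subZD XD_sub_act.

Lemma XD_neq0 : 'X + b%:P != 0 :> {poly C}.
Proof. by rewrite -size_poly_eq0 size_XaddC. Qed.

Lemma XD_nontrivial : nontrivial XD_submodule.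
Proof.
split=> E.
- have : sub_set XD_submodule ('X + b%:P : {poly C}).
    by exists (1 : {poly C}) => //; exact: mulr1.
  by rewrite E => /eqP; rewrite (negPf XD_neq0).
- have : sub_set XD_submodule (1 : {poly C}) by rewrite E.
  (* Evaluation at [- b] kills every multiple of ['X + b] but not 1. *)
  move=> [v _] /(congr1 (fun q : {poly C} => q.[- b])).
  rewrite /= hornerM hornerD hornerX !hornerC addNr mul0r => /esym/eqP.
  by rewrite oner_eq0.
Qed.

Lemma XD_unique : unique_nontrivial XD_submodule.
Proof.
split=> [|T [T0 T1]]; first exact: XD_nontrivial.
have TX (v : {poly C}) : sub_set T (('X + b%:P) * v).
  (* The coefficient obtained from [L_0] is [p ('X + b)]; multiplying it by [p^-1 v] gives the
     claim. *)
  have [+ _] := submodule_lead_coef T0 0%N.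
  rewrite VL0_0 lead_coefC => /(submoduleM (p^-1%:P * v)).
  rewrite mulrACA -polyCM mulVf ?mul1r; last exact/eqP.
  by rewrite mulrC.
apply/seteqP; split=> [g Tg|_ [v _ <-]]; last exact: TX.
(* Division of [g] by ['X + b] leaves the constant [g.[- b]], which lies in [T]. If it is nonzero,
   then [T] is the whole module, which is excluded. *)
have /factor_theorem[q] : root ((g : {poly C}) - (g : {poly C}).[- b]%:P) (- b).
  by rewrite /root hornerD hornerN hornerC subrr.
rewrite polyCN opprK => E.
have {E} gE : (g : {poly C}) = ('X + b%:P) * q + (g : {poly C}).[- b]%:P.
  by rewrite mulrC -E subrK.
have [g0|gn0] := eqVneq (g : {poly C}).[- b] 0.
  by exists q => //; rewrite gE g0 polyC0 addr0.
case: T1; apply: (submodule_full gn0).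
have -> : (g : {poly C}).[- b]%:P = -1 * (('X + b%:P) * q) + (g : {poly C}).
  by rewrite mulN1r {2}gE addKr.
exact: (subZD (-1) (TX q) Tg).
Qed.

Lemma XD_isomorphic :
  isomorphic (sub_module XD_submodule) (rank1_module 1 b hc' hd').
Proof.
(* The map is built from the module with a = 1, as multiplication by ['X + b]; its inverse is
   polynomial division, exact on the submodule. *)
apply: isomorphic_sym.
set W := rank1_module _ _ _ _; set S := sub_module _.
have inS (g : W) : ('X + b%:P) *: (g : V) \in sub_pred XD_submodule.
  by apply/sub_predP; exists g.
pose f (g : W) : S := exist _ (('X + b%:P) *: (g : V)) (inS g).
have f_lin : linear f.
  move=> k u v; apply: val_inj; rewrite linearP /=.
  by rewrite scalerDr !scalerA [X in X *: _]mulrC.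
pose f' : {linear W -> S} := HB.pack f (GRing.isLinear.Build _ _ _ _ f f_lin).
exists f'; split=> [|x n g]; last by apply: val_inj; exact: (esym (Vact_XD b x n g)).
pose h (s : S) : W := (val s : {poly C}) %/ ('X + b%:P).
have fK : cancel f h by move=> g; rewrite /h /= [_ *: _]mulrC mulpK // XD_neq0.
exists h => // s; have /sub_predP[v _ sE] := valP s.
have -> : s = f v by apply: val_inj; rewrite -sE.
by rewrite /= fK.
Qed.
End UniqueSubmodule.

(** * Irreducibility criterion and the four families *)

Lemma irreducible_rank1 (a b c d : C) hc hd (V : conformalModule (B alpha beta p)) :
  isomorphic V (@rank1_module C alpha beta p a b c d hc hd) ->
  (irreducible V <-> [\/ a <> 0, c <> 0 | d <> 0]).
Proof.
move=> /irreducible_isoE ->; split=> [[_ irr]|abc]; last first.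
  split; first by exists (1 : {poly C}); apply/eqP; exact: oner_neq0.
  by move=> [T [T0 T1]]; apply: T1; exact: submodule_trivial.
(* If a, c and d all vanish, the multiples of ['X + b] form a non-trivial submodule. *)
apply: contrapT => nabc; apply: irr.
have a0 : a = 0 by apply: contrapT => h; apply: nabc; apply: Or31.
have c0 : c = 0 by apply: contrapT => h; apply: nabc; apply: Or32.
have d0 : d = 0 by apply: contrapT => h; apply: nabc; apply: Or33.
subst a c d; exists (XD_submodule b hc hd); exact: XD_nontrivial.
Qed.

(** The proofs of the side conditions are arbitrary, so that each of the four families, built with
    its own proof terms, is an instance. *)
Lemma rank1_unique_submodule (b : C) hc hd hc' hd' :
  exists S : submodule (@rank1_module C alpha beta p 0 b 0 0 hc hd),
    [/\ unique_nontrivial S,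
        S = [set ('X + b%:P) *: v | v in setT] :> set _ &
        isomorphic (sub_module S) (@rank1_module C alpha beta p 1 b 0 0 hc' hd')].
Proof.
exists (XD_submodule b hc hd); split=> //; first exact: XD_unique.
exact: XD_isomorphic.
Qed.
End RankOneModules.

Theorem proposition4p5 (R : realType) (alpha beta p : R[i]) (hp : p <> 0) :
  [/\ (* V_{a,b} *)
      p <> -1 -> (alpha, beta) <> (p, 0) ->
      (forall (a b : R[i]) (V : conformalModule (B alpha beta p)),
         isomorphic V (V_ab alpha beta p a b) ->
         (irreducible V <-> a <> 0)) /\
      (forall b : R[i], exists S : submodule (V_ab alpha beta p 0 b),
         [/\ unique_nontrivial S,
             S = [set ('X + b%:P) *: v | v in setT] :> set _ &
             isomorphic (sub_module S) (V_ab alpha beta p 1 b)]),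
      (* V_{a,b,d} *)
      p <> -1 -> forall h : (alpha, beta) = (p, 0),
      (forall (a b d : R[i]) (V : conformalModule (B alpha beta p)),
         isomorphic V (V_abd h a b d) ->
         (irreducible V <-> a <> 0 \/ d <> 0)) /\
      (forall b : R[i], exists S : submodule (V_abd h 0 b 0),
         [/\ unique_nontrivial S,
             S = [set ('X + b%:P) *: v | v in setT] :> set _ &
             isomorphic (sub_module S) (V_abd h 1 b 0)]),
      (* V_{a,b,c} *)
      forall hp1 : p = -1, (alpha, beta) <> (-1, 0) ->
      (forall (a b c : R[i]) (V : conformalModule (B alpha beta p)),
         isomorphic V (V_abc alpha beta hp1 a b c) ->
         (irreducible V <-> a <> 0 \/ c <> 0)) /\
      (forall b : R[i], exists S : submodule (V_abc alpha beta hp1 0 b 0),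
         [/\ unique_nontrivial S,
             S = [set ('X + b%:P) *: v | v in setT] :> set _ &
             isomorphic (sub_module S) (V_abc alpha beta hp1 1 b 0)]) &
      (* V_{a,b,c,d} *)
      forall (hp1 : p = -1) (h : (alpha, beta) = (-1, 0)),
      (forall (a b c d : R[i]) (V : conformalModule (B alpha beta p)),
         isomorphic V (V_abcd hp1 h a b c d) ->
         (irreducible V <-> [\/ a <> 0, c <> 0 | d <> 0])) /\
      (forall b : R[i], exists S : submodule (V_abcd hp1 h 0 b 0 0),
         [/\ unique_nontrivial S,
             S = [set ('X + b%:P) *: v | v in setT] :> set _ &
             isomorphic (sub_module S) (V_abcd hp1 h 1 b 0 0)])].
Proof.
split=> [_ _|_ h|hp1 _|hp1 h]; split=> [*|b]; try exact: rank1_unique_submodule.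
(* In each family, the parameters fixed at 0 give disjuncts [0 <> 0], refuted by reflexivity. *)
- rewrite irreducible_rank1 //; last eassumption.
  by split=> [[//|/(_ erefl)|/(_ erefl)]|]; [| | apply: Or31].
- rewrite irreducible_rank1 //; last eassumption.
  by split=> [[|/(_ erefl)|]|[]] //; [left|right|apply: Or31|apply: Or33].
- rewrite irreducible_rank1 //; last eassumption.
  by split=> [[||/(_ erefl)]|[]] //; [left|right|apply: Or31|apply: Or32].
- by rewrite irreducible_rank1 //; last eassumption.
Qed.
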